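(* Let $n \geq 2$ be an integer. Then the $n$-note Pythagorean scale $P_n$ has the $2$-step property if and only if $n$ is the denominator of a semi-convergent of $\log_2(3)$.
   Context: Pythagorean scales. For an integer $n \geq 1$, the $n$-note Pythagorean scale is the finite set of real numbers $$P_n = \left\{ \frac{3^b}{2^a} \;\middle|\; a,b \in \mathbb{Z},\ 0 \leq b < n,\ 1 \leq \frac{3^b}{2^a} \leq 2 \right\}.$$ (It contains both $1 = 3^0/2^0$ and $2 = 3^0/2^{-1}$, and exactly one element $3^b/2^a$ for each $0<b<n$.) $k$-step property. Arrange the elements of $P_n$ in increasing numerical order as $x_0 < x_1 < \cdots < x_n$. For an integer $k \geq 1$, $P_n$ has the $k$-step property if there are exactly $k$ distinct values among the successive ratios $x_{j+1}/x_j$, $0 \leq j < n$. Continued fraction notation. Let $\log_2(3) = [k_0; k_1, k_2, \ldots]$ be the (simple, infinite) continued fraction expansion of the irrational number $\log_2(3)$, where the $k_i$ are positive integers; it begins $[1;1,1,2,2,3,1,5,2,23,\ldots]$. The numerators $a_i$ and denominators $b_i$ of its convergents $[k_0;k_1,\ldots,k_i] = a_i/b_i$ are given by $a_{-1}=1$, $a_0=k_0$, $b_{-1}=0$, $b_0=1$ and, for $i \geq 1$, $$a_i = k_i a_{i-1} + a_{i-2}, \qquad b_i = k_i b_{i-1} + b_{i-2}.$$ Semi-convergents. The semi-convergents of $\log_2(3)$ are the rational numbers $$\frac{a_{i-1} + k a_i}{b_{i-1} + k b_i}$$ for integers $i \geq 1$ and $0 \leq k \leq k_{i+1}$; the denominator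 of such a semi-convergent is $b_{i-1} + k b_i$. *)

(* Defs.v *)
From HB Require Import structures.
From mathcomp Require Import all_boot all_order all_algebra.
From mathcomp Require Import all_classical all_reals all_analysis.
Set Implicit Arguments.
Unset Strict Implicit.
Unset Printing Implicit Defensive.
Import Order.TTheory GRing.Theory Num.Theory.
Local Open Scope classical_set_scope.
Local Open Scope ring_scope.

Definition pythagorean_scale (R : realType) (n : nat) : set R :=
  [set x | exists a b : int,
     [/\ 0 <= b, b < n%:Z, x = 3 ^ b / 2 ^ a & 1 <= x <= 2]].

(* The increasing enumeration [x 0 < ... < x n] is unique on indices [<= n];
   its values beyond [n] are irrelevant. *)
Definition step_property (R : realType) (n k : nat) : Prop :=
  exists x : nat -> R,
    [/\ forall j, (j < n)%N -> x j < x j.+1,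
        x @` `I_n.+1 = pythagorean_scale n &
        ([set x j.+1 / x j | j in `I_n] #= `I_k)%card].

Definition log2_3 (R : realType) : R := ln 3 / ln 2.

(* The complete quotients of [x], for [x] irrational; on a rational [x] the
   expansion should stop, whereas here the quotients become [0] ([0^-1 = 0]). *)
Fixpoint cf_quotient (R : realType) (x : R) (i : nat) : R :=
  if i is j.+1 then
    (cf_quotient x j - (Num.floor (cf_quotient x j))%:~R)^-1
  else x.

Definition cf_coef (R : realType) (x : R) (i : nat) : int :=
  Num.floor (cf_quotient x i).

(* [cf_rec u v x m] has its index shifted by one: it is the solution at [m - 1]
   of [c_i = k_i c_(i-1) + c_(i-2)] with [c_(-1) = u] and [c_0 = v]. *)
Fixpoint cf_rec (R : realType) (u v : int) (x : R) (m : nat) : int :=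
  match m with
  | 0 => u
  | 1 => v
  | (p.+1 as q).+1 => cf_coef x q * cf_rec u v x q + cf_rec u v x p
  end.

Definition cf_num (R : realType) (x : R) (i : nat) : int :=
  cf_rec 1 (cf_coef x 0) x i.+1.

Definition cf_den (R : realType) (x : R) (i : nat) : int :=
  cf_rec 0 1 x i.+1.

Definition semiconvergent (R : realType) (x : R) : set rat :=
  [set q | exists (i : nat) (k : int),
     [/\ (1 <= i)%N, 0 <= k <= cf_coef x i.+1 &
         q = (cf_num x i.-1 + k * cf_num x i)%:~R
             / (cf_den x i.-1 + k * cf_den x i)%:~R]].

(* Main.v *)
(* Write [L = log2 3].  On the logarithmic scale [P_n] is the set of fractional
   parts of [b * L], [0 <= b < n], together with the end point 1.  If [p / u] and
   [q / v] are the neighbours of [L] in the Farey-like sense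
   [u * q - v * p = 1], [p / u < L < q / v], with [u, v < n <= u + v], then every
   integer form [m * L - l] is a combination of [A = u * L - p] and
   [B = q - v * L], and looking at the signs of the coefficients gives the three
   gap theorem: the steps are [A], [B] and, exactly when [n < u + v], [A + B].
   So the 2-step property says [n = u + v].  Such a pair [u, v] is always of the
   form [b_i], [b_(i-1) + k * b_i] with [0 <= k < k_(i+1)] (in an order that
   depends on the parity of [i]), so [u + v] runs over the denominators
   [b_(i-1) + (k + 1) * b_i] of the semi-convergents. *)
Require Import Defs.
From mathcomp Require Import all_boot all_order all_algebra.
From mathcomp Require Import all_classical all_reals all_analysis.
From mathcomp Require Import zify ring lra.
Import Order.TTheory GRing.Theory Num.Theory.
Local Open Scope ring_scope.

(** * Integer linear forms and the three gap argument *)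

Definition lin {R : realType} (x : R) (m l : int) : R := m%:~R * x - l%:~R.

(** [m = 0] forces [l = 0] as well, so this is linear independence of [x] and 1 over the
    integers. *)
Definition irrational {R : realType} (x : R) : Prop :=
  forall m l : int, lin x m l = 0 -> m = 0.

Lemma lin0 (R : realType) (x : R) (l : int) : lin x 0 l = - l%:~R.
Proof. by rewrite /lin mul0r sub0r. Qed.

Lemma linD (R : realType) (x : R) (m l m' l' : int) :
  lin x (m + m') (l + l') = lin x m l + lin x m' l'.
Proof. by rewrite /lin !rmorphD /=; ring. Qed.

Lemma linB (R : realType) (x : R) (m l m' l' : int) :
  lin x (m - m') (l - l') = lin x m l - lin x m' l'.
Proof. by rewrite /lin !rmorphB /=; ring. Qed.

Lemma linZ (R : realType) (x : R) (k m l : int) :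
  lin x (k * m) (k * l) = k%:~R * lin x m l.
Proof. by rewrite /lin !rmorphM /=; ring. Qed.

Definition farey_pair {R : realType} (x : R) (u p v q : int) : Prop :=
  [/\ 0 < u, 0 < v, u * q - v * p = 1, 0 < lin x u p & lin x v q < 0].

(** Determinant 1 makes [(u, p)], [(v, q)] a basis of the integer plane; the coefficients come from
    Cramer's rule. The minus sign lets [i] and [j] both multiply positive reals for a Farey pair. *)
Lemma lin_farey (R : realType) (x : R) (u p v q m l : int) :
  u * q - v * p = 1 ->
  exists i j : int, [/\ m = i * u - j * v, l = i * p - j * q &
    lin x m l = i%:~R * lin x u p - j%:~R * lin x v q].
Proof.
move=> det; exists (m * q - l * v), (m * p - l * u).
have em : m = (m * q - l * v) * u - (m * p - l * u) * v.
  by rewrite -[LHS]mulr1 -det; ring.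
have el : l = (m * q - l * v) * p - (m * p - l * u) * q.
  by rewrite -[LHS]mulr1 -det; ring.
by split=> //; rewrite -!linZ -linB -em -el.
Qed.

(* [(m, l)] such that the note after [3 ^ b / 2 ^ a] in the [n]-note scale is
   [3 ^ (b + m) / 2 ^ (a + l)]; it does not depend on [a]. *)
Definition next_shift (u p v q n b : int) : int * int :=
  if b + u < n then (u, p) else if v <= b then (- v, - q) else (u - v, p - q).

Lemma intr_mul_ge (R : realType) (i : int) (y : R) :
  0 < i -> 0 < y -> y <= i%:~R * y.
Proof. by move=> i0 y0; rewrite ler_peMl ?(ltW y0)// ler1z; lia. Qed.

Lemma intr_mul_le0 (R : realType) (i : int) (y : R) :
  i <= 0 -> 0 < y -> i%:~R * y <= 0.
Proof. by move=> i0 y0; apply: mulr_le0_ge0 (ltW y0); rewrite lerz0. Qed.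

Lemma next_shiftP (R : realType) (x : R) (u p v q n b : int) :
  farey_pair x u p v q -> u < n -> v < n -> n <= u + v -> 0 <= b < n ->
  let s := next_shift u p v q n b in
  [/\ 0 <= b + s.1 < n, 0 < lin x s.1 s.2 &
      forall m l : int, 0 <= b + m < n -> 0 < lin x m l ->
        lin x s.1 s.2 <= lin x m l].
Proof.
move=> [u0 v0 det A0]; rewrite -oppr_gt0 => B0 un vn nuv bn s.
have [A [B [eA eB]]] : exists A B, A = lin x u p /\ B = - lin x v q.
  by exists (lin x u p), (- lin x v q).
have lowP m l : 0 < lin x m l -> exists i j : int,
  [/\ m = i * u - j * v, lin x m l = i%:~R * A + j%:~R * B &
      0 < i \/ 0 < j].
  have [i [j [-> _ ->]]] := lin_farey R x _ _ _ _ m l det.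
  rewrite -eA -mulrN -eB => h; exists i, j; split => //.
  case: (ltP 0 i) => [|i0]; first by left.
  case: (ltP 0 j) => [|j0]; first by right.
  have : i%:~R * A + j%:~R * B <= 0.
    by rewrite -(addr0 0) lerD// intr_mul_le0// ?eA ?eB.
  by rewrite leNgt h.
rewrite -eA in A0; rewrite -eB in B0.
have low2 (i j : int) : 0 < i -> 0 < j -> A + B <= i%:~R * A + j%:~R * B.
  by move=> i0 j0; rewrite lerD// intr_mul_ge.
have mono_u (i : int) : (0 < i -> u <= i * u) /\ (i <= 0 -> i * u <= 0).
  by split; nia.
have mono_v (j : int) : (0 < j -> v <= j * v) /\ (j <= 0 -> j * v <= 0).
  by split; nia.
have linN : lin x (- v) (- q) = B by rewrite eB /lin !rmorphN /=; ring.
have linuv : lin x (u - v) (p - q) = A + B by rewrite linB eA eB.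
have casesP m l : 0 <= b + m < n -> 0 < lin x m l ->
  [\/ A + B <= lin x m l, A <= lin x m l /\ b + u < n
    | B <= lin x m l /\ v <= b].
  move=> bm /lowP[i [j [em -> ij]]].
  have [iu iu'] := mono_u i; have [jv jv'] := mono_v j.
  case: (ltP 0 i) => i0; case: (ltP 0 j) => j0; last by lia.
  - by constructor 1; apply: low2.
  (* Coefficients of opposite signs give [|m| >= u + v >= n], too large a shift to stay in the range
     [[0, n)]; hence the other coefficient is 0 here and in the symmetric case. *)
  - have j0' : j = 0 \/ j < 0 by lia.
    case: j0' => [j00|j0']; last by exfalso; nia.
    constructor 2; rewrite j00 mul0r addr0; split; first exact: intr_mul_ge.
    by move: (iu i0) em bm; rewrite j00; lia.
  - have i0' : i = 0 \/ i < 0 by lia.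
    case: i0' => [i00|i0']; last by exfalso; nia.
    constructor 3; rewrite i00 mul0r add0r; split; first exact: intr_mul_ge.
    by move: (jv j0) em bm; rewrite i00; lia.
rewrite /s /next_shift; case: ifPn => [bu|bu] /=.
  rewrite -eA; split=> [|//|m l bm /(casesP _ _ bm)]; first by lia.
  by case=> [|[]|[_]]//; [lra|lia].
case: ifPn => [bv|bv] /=.
  rewrite linN; split=> [|//|m l bm /(casesP _ _ bm)]; first by lia.
  by case=> [|[_]|[]]//; [lra|lia].
rewrite linuv; split=> [||m l bm /(casesP _ _ bm)]; [lia|lra|].
by case=> [//|[_]|[_]]; lia.
Qed.

(** * Convergents and their errors *)

Lemma cf_recS (R : realType) (u v : int) (x : R) (m : nat) :
  cf_rec u v x m.+2 = cf_coef x m.+1 * cf_rec u v x m.+1 + cf_rec u v x m.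
Proof. by []. Qed.

Lemma cf_rec_det (R : realType) (x : R) (c : int) (m : nat) :
  cf_rec 1 c x m * cf_rec 0 1 x m.+1 - cf_rec 1 c x m.+1 * cf_rec 0 1 x m
  = (-1) ^+ m.
Proof.
elim: m => [|m IHm]; first by rewrite /= mulr0 subr0 mulr1.
by rewrite exprS -IHm !(cf_recS R _ _ x m); ring.
Qed.

(* As in [cf_rec] the index is shifted by one: this is [b_(m-1) x - a_(m-1)]. *)
Definition cf_err {R : realType} (x : R) (m : nat) : R :=
  lin x (cf_rec 0 1 x m) (cf_rec 1 (cf_coef x 0) x m).

Lemma cf_errS (R : realType) (x : R) (m : nat) :
  cf_err x m.+2 = (cf_coef x m.+1)%:~R * cf_err x m.+1 + cf_err x m.
Proof. by rewrite /cf_err !cf_recS -linZ -linD. Qed.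

Lemma cf_quotient_step (R : realType) (x : R) (i : nat) :
  cf_quotient x i != (cf_coef x i)%:~R ->
  1 < cf_quotient x i.+1 /\
  (cf_quotient x i - (cf_coef x i)%:~R) * cf_quotient x i.+1 = 1.
Proof.
rewrite -subr_eq0 => ne; have /andP[] := floor_itv (cf_quotient x i).
rewrite intrD -/(cf_coef x i) => le1 lt1; split; last by rewrite /= divff.
by rewrite /= -/(cf_coef x i) invf_gt1 ?lt_def ?ne /=; lra.
Qed.

(** The third clause turns the recurrence into [E_(m+2) = (k - X) E_(m+1)], where [X] is the
    complete quotient of index [m + 1] and [k] its floor: the errors alternate in sign.
    Irrationality keeps [X] from being an integer, so the next quotient exceeds 1. *)
Lemma cf_invariant (R : realType) (x : R) (m : nat) : irrational x ->
  [/\ 0 <= cf_rec 0 1 x m, 0 < cf_rec 0 1 x m.+1,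
      cf_err x m = - cf_quotient x m.+1 * cf_err x m.+1,
      0 < (-1) ^+ m * cf_err x m.+1 & 1 < cf_quotient x m.+1].
Proof.
move=> irr; elim: m => [|m [Q0 Q1 E0 E1 X1]].
  have E1 : cf_err x 1 = cf_quotient x 0 - (cf_coef x 0)%:~R.
    by rewrite /cf_err /lin /= mul1r.
  have ne : cf_quotient x 0 != (cf_coef x 0)%:~R.
    by rewrite -subr_eq0 -E1; apply/eqP => /irr.
  have [X1 X] := cf_quotient_step R x 0 ne.
  split=> //.
    by rewrite E1 mulNr mulrC X /cf_err /lin mul0r sub0r.
  rewrite mul1r E1 lt_def subr_eq0 ne subr_ge0 /=.
  by case/andP: (floor_itv (cf_quotient x 0)).
have k1 : 1 <= cf_coef x m.+1.
  by rewrite /cf_coef floor_ge_int ltW.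
have Q2 : 0 < cf_rec 0 1 x m.+2.
  by rewrite cf_recS; nia.
have E2 : cf_err x m.+2 =
    ((cf_coef x m.+1)%:~R - cf_quotient x m.+1) * cf_err x m.+1.
  by rewrite cf_errS E0; ring.
(* Equality would make [x] the rational number [a_(m+1) / b_(m+1)]. *)
have ne : cf_quotient x m.+1 != (cf_coef x m.+1)%:~R.
  apply/eqP => e; move: E2; rewrite e subrr mul0r => /irr E2.
  by rewrite E2 in Q2.
have [X2 X] := cf_quotient_step R x m.+1 ne.
have lt1 : 0 < cf_quotient x m.+1 - (cf_coef x m.+1)%:~R.
  rewrite lt_def subr_eq0 ne subr_ge0 /=.
  by case/andP: (floor_itv (cf_quotient x m.+1)).
split=> //; first exact: ltW.
  by rewrite E2 -[LHS]mul1r -{1}X; move: (cf_quotient x m.+2) => y; ring.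
rewrite E2 exprS.
rewrite (_ : _ * _ = (cf_quotient x m.+1 - (cf_coef x m.+1)%:~R) *
  ((-1) ^+ m * cf_err x m.+1)); first exact: mulr_gt0.
by ring.
Qed.

Lemma cf_coef_ge1 (R : realType) (x : R) (i : nat) :
  irrational x -> 1 <= cf_coef x i.+1.
Proof.
move=> irr; have [_ _ _ _ X1] := cf_invariant R x i irr.
by rewrite /cf_coef floor_ge_int ltW.
Qed.

(** * Semi-convergents, Farey pairs and denominators *)

(** The error of the semi-convergent is [k - X] times that of the convergent [a_i / b_i], where [X]
    is the complete quotient of index [i + 1]. As [k < X], the two fractions lie on opposite sides
    of [x]; parity tells which is below. *)
Lemma semiconvergent_farey_pair (R : realType) (x : R) (i : nat) (k : int) :
  irrational x -> (0 < i)%N -> 0 <= k < cf_coef x i.+1 ->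
  exists u p v q : int, farey_pair x u p v q /\
    (u = cf_den x i /\ v = cf_den x i.-1 + k * cf_den x i \/
     u = cf_den x i.-1 + k * cf_den x i /\ v = cf_den x i).
Proof.
case: i => // i irr _ /andP[k0 kK]; rewrite /cf_den /=.
have [_ Q1 _ _ _] := cf_invariant R x i irr.
have [_ Q2 E1 E2 X2] := cf_invariant R x i.+1 irr.
set c := cf_coef x 0; set K := cf_coef x i.+2 in kK.
have det := cf_rec_det R x c i.+1.
have Xk : k%:~R < cf_quotient x i.+2.
  by rewrite (lt_le_trans _ (floor_le _))// ltr_int.
set b := cf_rec 0 1 x i.+1 + k * cf_rec 0 1 x i.+2.
set a := cf_rec 1 c x i.+1 + k * cf_rec 1 c x i.+2.
have ba : lin x b a = (k%:~R - cf_quotient x i.+2) * cf_err x i.+2.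
  by rewrite /b /a linD linZ -/(cf_err x i.+1) -/(cf_err x i.+2) E1; ring.
have b0 : 0 < b by rewrite /b; nia.
have detb : cf_rec 0 1 x i.+2 * a - b * cf_rec 1 c x i.+2 = (-1) ^+ i.+1.
  by rewrite -det /a /b; ring.
move: E2 detb; rewrite -signr_odd -(signr_odd _ i.+1).
case: (odd i.+1); rewrite ?expr1 ?expr0 ?mul1r ?mulN1r => E2 detb.
  exists b, a, (cf_rec 0 1 x i.+2), (cf_rec 1 c x i.+2).
  split; last by right.
  split=> //; [lia | | ].
    by rewrite ba; nra.
  by rewrite -/(cf_err x i.+2); lra.
exists (cf_rec 0 1 x i.+2), (cf_rec 1 c x i.+2), b, a.
split; last by left.
by split=> //; rewrite ba; nra.
Qed.

Lemma semiconvergent_coprime (R : realType) (x : R) (i : nat) (k : int) :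
  coprimez (cf_num x i + k * cf_num x i.+1) (cf_den x i + k * cf_den x i.+1).
Proof.
apply/coprimezP; rewrite /cf_num /cf_den.
have := cf_rec_det R x (cf_coef x 0) i.+1.
move: (cf_rec 1 _ x i.+1) (cf_rec 1 _ x i.+2) => a a'.
move: (cf_rec 0 1 x i.+1) (cf_rec 0 1 x i.+2) => b b' det.
(* Bezout coefficients read off the determinant identity; the terms in [k] cancel. *)
exists ((-1) ^+ i.+1 * b', - (-1) ^+ i.+1 * a') => /=.
transitivity ((-1) ^+ i.+1 * (a * b' - a' * b)); first by ring.
by rewrite det -expr2 sqrr_sign.
Qed.

Lemma denq_semiconvergent (R : realType) (x : R) (i : nat) (k : int) :
  irrational x -> 0 <= k ->
  denq ((cf_num x i + k * cf_num x i.+1)%:~R /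
        (cf_den x i + k * cf_den x i.+1)%:~R) = cf_den x i + k * cf_den x i.+1.
Proof.
move=> irr k0; rewrite coprimeq_den; last exact: semiconvergent_coprime.
have [Q0 Q1 _ _ _] := cf_invariant R x i irr.
have [_ Q2 _ _ _] := cf_invariant R x i.+1 irr.
have h : 0 < cf_den x i + k * cf_den x i.+1 by rewrite /cf_den; nia.
by rewrite gt_eqF // gtr0_norm.
Qed.

Lemma semiconvergent_denqP (R : realType) (x : R) (n : int) :
  irrational x ->
  (exists q, semiconvergent x q /\ denq q = n) <->
  exists (i : nat) (k : int), [/\ (0 < i)%N, 0 <= k <= cf_coef x i.+1 &
    n = cf_den x i.-1 + k * cf_den x i].
Proof.
move=> irr; split=> [[q [[[|i] [k [// _ /andP[k0 kK] ->]]] <-]]|].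
  by exists i.+1, k; rewrite denq_semiconvergent // k0 kK.
move=> [[|i] [k [// _ /andP[k0 kK] ->]]]; eexists; split.
  by exists i.+1, k; split=> //; rewrite k0 kK.
exact: denq_semiconvergent.
Qed.

(** The form with [l + 1] is the sum [u + v] of a Farey pair. The case [k = 0] gives [b_(i-1)],
    which is the last semi-convergent denominator of level [i - 2], unless it is [b_0] or [b_1],
    both equal to 1 as [k_1 = 1]. *)
Lemma semiconvergent_den_gt1 (R : realType) (x : R) (i : nat) (k : int) :
  irrational x -> cf_coef x 1 = 1 -> (0 < i)%N -> 0 <= k <= cf_coef x i.+1 ->
  1 < cf_den x i.-1 + k * cf_den x i ->
  exists (j : nat) (l : int), [/\ (0 < j)%N, 0 <= l < cf_coef x j.+1 &
    cf_den x i.-1 + k * cf_den x i = cf_den x j.-1 + (l + 1) * cf_den x j].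
Proof.
move=> irr x1; case: i => // i _ /andP[k0 kK].
have [k00|k1] : k = 0 \/ 1 <= k by lia.
  rewrite k00 mul0r addr0; case: i {kK} => [//|[|i _]].
    by rewrite /cf_den /= x1.
  have := cf_coef_ge1 R x i.+1 irr => K1.
  exists i.+1, (cf_coef x i.+2 - 1); split; [by []|lia|].
  by rewrite subrK /cf_den cf_recS addrC.
by exists i.+1, (k - 1); split; [by []|lia|rewrite subrK].
Qed.

Lemma cf_denS (R : realType) (x : R) (i : nat) :
  cf_den x i.+2 = cf_coef x i.+2 * cf_den x i.+1 + cf_den x i.
Proof. by []. Qed.

Lemma cf_den_gt0 (R : realType) (x : R) (i : nat) :
  irrational x -> 0 < cf_den x i.
Proof. by move=> irr; case: (cf_invariant R x i irr). Qed.

(** Induction from [b_0 = b_1 = 1] at [n = 2]. Once [n] passes the upper bound, [k] increases by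
    one; if [k + 1 = k_(i+1)], that bound is [b_(i+1)] and the next level starts at [k = 0]. *)
Lemma semiconvergent_den_cover (R : realType) (x : R) (n : nat) :
  irrational x -> cf_coef x 1 = 1 -> (2 <= n)%N ->
  exists (i : nat) (k : int), [/\ (0 < i)%N, 0 <= k < cf_coef x i.+1,
    cf_den x i < n, cf_den x i.-1 + k * cf_den x i < n &
    n%:Z <= cf_den x i.-1 + (k + 1) * cf_den x i].
Proof.
move=> irr x1; elim: n => [//|[//|[_ _|n /(_ isT)]]].
  have := cf_coef_ge1 R x 1 irr => K1.
  by exists 1, 0; rewrite /cf_den cf_recS x1; split => //=; lia.
move=> [[|i] [k [// _ /andP[k0 kK]]]]; rewrite [i.+1.-1]/= => h1 h2 h3 _.
have d0 := cf_den_gt0 R x i irr.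
have d1 := cf_den_gt0 R x i.+1 irr.
have [h|h] : n.+3%:Z <= cf_den x i + (k + 1) * cf_den x i.+1 \/
  n.+2%:Z = cf_den x i + (k + 1) * cf_den x i.+1 by lia.
  by exists i.+1, k; rewrite [i.+1.-1]/=; split=> //; lia.
have [h'|h'] : k + 1 < cf_coef x i.+2 \/ k + 1 = cf_coef x i.+2 by lia.
  by exists i.+1, (k + 1); rewrite [i.+1.-1]/=; split=> //; lia.
have := cf_coef_ge1 R x i.+2 irr => K1.
exists i.+2, 0; rewrite [i.+2.-1]/= cf_denS -h'.
by split=> //; lia.
Qed.

(** * Counting a list; notes on the logarithmic scale *)

Lemma card_eq_seq (T : eqType) (s : seq T) :
  uniq s -> ([set` s]%classic #= `I_(size s))%card.
Proof.
case: s => [_|x0 s us]; first by rewrite set_nil /= II0.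
rewrite (_ : [set` x0 :: s] =
  [set nth x0 (x0 :: s) i | i in `I_(size (x0 :: s))])%classic.
  apply: inj_card_eq => i j; rewrite !inE => si sj /eqP.
  by rewrite nth_uniq // => /eqP.
apply/seteqP; split=> y /=; first by move/(nthP x0) => [i si <-]; exists i.
by move=> [i si <-]; exact: mem_nth.
Qed.

Lemma ln2_gt0 (R : realType) : 0 < ln 2 :> R.
Proof. by rewrite ln_gt0// ltr1n. Qed.

Definition pyth (R : realType) (m l : int) : R := 3 ^ m / 2 ^ l.

Lemma pyth_expR (R : realType) (m l : int) :
  pyth R m l = expR (ln 2 * lin (log2_3 R) m l).
Proof.
have l2 : ln 2 != 0 :> R by rewrite gt_eqF// ln2_gt0.
rewrite /pyth -!powR_intmul// /powR !gt_eqF//= -expRN -expRD.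
by congr expR; rewrite /lin /log2_3; field.
Qed.

Lemma lt_pyth (R : realType) (m l m' l' : int) :
  (pyth R m l < pyth R m' l') =
  (lin (log2_3 R) m l < lin (log2_3 R) m' l').
Proof. by rewrite !pyth_expR ltr_expR ltr_pM2l// ln2_gt0. Qed.

Lemma le_pyth (R : realType) (m l m' l' : int) :
  (pyth R m l <= pyth R m' l') =
  (lin (log2_3 R) m l <= lin (log2_3 R) m' l').
Proof. by rewrite leNgt lt_pyth -leNgt. Qed.

Lemma pyth_div (R : realType) (m l m' l' : int) :
  pyth R (m + m') (l + l') / pyth R m l = pyth R m' l'.
Proof. by rewrite !pyth_expR -expRN -expRD -mulrN -mulrDr linD addrC addKr. Qed.

Lemma pyth00 (R : realType) : pyth R 0 0 = 1.
Proof. by rewrite /pyth !expr0z divr1. Qed.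

Lemma pyth0N1 (R : realType) : pyth R 0 (-1) = 2.
Proof. by rewrite /pyth expr0z exprN1 invrK mul1r. Qed.

Lemma pyth_sub (R : realType) (m l m' l' : int) :
  pyth R m l = pyth R m' l' -> lin (log2_3 R) (m - m') (l - l') = 0.
Proof.
move=> e; rewrite linB; apply/eqP; rewrite subr_eq0; apply/eqP/le_anti.
by rewrite -!le_pyth e lexx.
Qed.

(** A zero with [m > 0] gives [3 ^ m = 2 ^ l] with [l > 0], against parity; a change of sign handles
    [m < 0]. *)
Lemma log2_3_irrational (R : realType) : irrational (log2_3 R).
Proof.
have pos (n : nat) (l : int) : lin (log2_3 R) n.+1 l <> 0.
  move=> h; have : pyth R n.+1 l = 1 by rewrite pyth_expR h mulr0 expR0.
  have L0 : 0 < log2_3 R by rewrite /log2_3 divr_gt0 ?ln2_gt0// ln_gt0// ltr1n.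
  have : 0 < l%:~R :> R.
    by move: h; rewrite /lin => /subr0_eq <-; rewrite mulr_gt0// ltr0z.
  rewrite ltr0z; case: l {h} => // -[//|l] _.
  rewrite /pyth => /divr1_eq /eqP; rewrite -!exprnP -!natrX eqr_nat => /eqP.
  by move/(congr1 odd); rewrite !oddX.
move=> m l; case: m => [[//|n]|n] h; first by case: (pos n l).
case: (pos n (- l)).
by rewrite -[LHS]opprK -oppr0 -h /lin NegzE !rmorphN /=; ring.
Qed.

Lemma pyth_inj (R : realType) (m l m' l' : int) :
  pyth R m l = pyth R m' l' -> m = m' /\ l = l'.
Proof.
move=> /pyth_sub e; have em : m = m'.
  by apply/eqP; rewrite -subr_eq0 (log2_3_irrational R _ _ e).
split=> //; apply/eqP; rewrite -subr_eq0 -(intr_eq0 R).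
by move: e; rewrite em /lin subrr mul0r sub0r => /eqP; rewrite oppr_eq0.
Qed.

Lemma cf_coef_log2_3_1 (R : realType) : cf_coef (log2_3 R) 1 = 1.
Proof.
(* From [9/8 > 1] and [3/4 < 1], [log2 3] lies between 3/2 and 2, so the inverse of its fractional
   part lies between 1 and 2. *)
have h1 : 0 < lin (log2_3 R) 2 3.
  by have := lt_pyth R 0 0 2 3; rewrite lin0 oppr0 => <-;
     rewrite /pyth -!exprnP; lra.
have h2 : lin (log2_3 R) 1 2 < 0.
  by have := lt_pyth R 1 2 0 0; rewrite lin0 oppr0 => <-;
     rewrite /pyth -!exprnP; lra.
rewrite /lin in h1 h2.
have f0 : Num.floor (log2_3 R) = 1 by apply: floor_def; lra.
rewrite /cf_coef /= f0; apply: floor_def.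
have p : 0 < log2_3 R - 1 by lra.
by rewrite -[_^-1]mul1r ler_pdivlMr // ltr_pdivrMr //; lra.
Qed.

(** * The scale, its enumeration and its ratios *)

Lemma pythagorean_scaleP (R : realType) (n : nat) (y : R) :
  pythagorean_scale n y <-> exists b a : int,
    [/\ 0 <= b < n%:Z, y = pyth R b a & 0 <= lin (log2_3 R) b a <= 1].
Proof.
have e b a : (1 <= pyth R b a <= 2) = (0 <= lin (log2_3 R) b a <= 1).
  have := le_pyth R 0 0 b a; rewrite pyth00 lin0 oppr0 => ->.
  by have := le_pyth R b a 0 (-1); rewrite pyth0N1 lin0 rmorphN opprK => ->.
split=> [[a [b [b0 bn -> h]]]|[b [a [/andP[b0 bn] -> h]]]].
  by exists b, a; rewrite b0 bn -e.
by exists a, b; split=> //; rewrite e.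
Qed.

Lemma increasing_lt (R : realType) (x : nat -> R) (n i j : nat) :
  (forall j, (j < n)%N -> x j < x j.+1) -> (i < j)%N -> (j <= n)%N -> x i < x j.
Proof.
move=> incx; elim: j => // j IHj; rewrite ltnS leq_eqVlt => /predU1P[->|ij] jn.
  exact: incx.
by apply: lt_trans (incx _ jn); apply: IHj ij (ltnW jn).
Qed.

Lemma pythagorean_ratio (R : realType) (n : nat) (x : nat -> R)
    (u p v q b a : int) (j : nat) :
  farey_pair (log2_3 R) u p v q -> u < n -> v < n -> n%:Z <= u + v ->
  (forall j, (j < n)%N -> x j < x j.+1) ->
  (x @` `I_n.+1 = pythagorean_scale n)%classic ->
  (j < n)%N -> 0 <= b < n%:Z -> x j = pyth R b a ->
  let s := next_shift u p v q n b in x j.+1 / x j = pyth R s.1 s.2.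
Proof.
move=> fp un vn nuv incx imx jn bn xj s.
have [bs s0 smin] := next_shiftP R _ u p v q n b fp un vn nuv bn.
rewrite -/s in bs s0 smin.
have xP k : (k <= n)%N -> pythagorean_scale n (x k).
  by move=> kn; rewrite -imx; exists k.
have /pythagorean_scaleP[b' [a' [bn' xj' /andP[_ le1']]]] := xP _ jn.
have /pythagorean_scaleP[b0 [a0 [_ xj0 /andP[ge0 _]]]] := xP _ (ltnW jn).
move: (xj0); rewrite xj => /pyth_inj[eb ea].
rewrite -eb -ea in ge0.
have lt' := incx _ jn; rewrite xj xj' lt_pyth in lt'.
have yP : pythagorean_scale n (pyth R (b + s.1) (a + s.2)).
  apply/pythagorean_scaleP; exists (b + s.1), (a + s.2); split=> //.
  rewrite linD addr_ge0 ?(ltW s0)//=.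
  (* The end point 2 is itself reached by an admissible shift, so minimality keeps the candidate
     note at most 2. *)
  have e1 : lin (log2_3 R) (0 - b) (-1 - a) = 1 - lin (log2_3 R) b a.
    by rewrite linB lin0 rmorphN opprK.
  have bb : 0 <= b + (0 - b) < n%:Z by lia.
  have := smin (0 - b) (-1 - a) bb; rewrite e1 subr_gt0.
  by move=> /(_ (lt_le_trans lt' le1')); lra.
suff xj1 : x j.+1 = pyth R (b + s.1) (a + s.2) by rewrite xj1 pyth_div.
apply/le_anti/andP; split.
  move: yP; rewrite -imx => -[k /= kn yk]; rewrite -yk.
  have jk : (j < k)%N.
    rewrite ltnNge; apply/negP; rewrite leq_eqVlt => /orP[/eqP e|kj].
      by move: s0; rewrite -(ltrD2l (lin (log2_3 R) b a)) addr0 -linD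
        -lt_pyth -yk e xj ltxx.
    have := increasing_lt R x n k j incx kj (ltnW jn).
    by rewrite yk xj lt_pyth linD ltNge lerDl (ltW s0).
  move: jk; rewrite leq_eqVlt => /orP[/eqP-> //|jk].
  by rewrite ltW // (increasing_lt R x n).
rewrite xj' le_pyth linD -lerBrDl -linB; apply: smin.
  by rewrite subrKC.
by rewrite linB subr_gt0.
Qed.

Definition shift_seq (u p v q n : int) : seq (int * int) :=
  [:: (u, p); (- v, - q)] ++ if n < u + v then [:: (u - v, p - q)] else [::].

Lemma next_shift_image (u p v q n : int) :
  0 < u < n -> 0 < v < n -> n <= u + v ->
  ([set next_shift u p v q n b | b in [set b | 0 <= b < n]] =
   [set` shift_seq u p v q n])%classic.
Proof.
move=> un vn nuv; apply/seteqP; split=> s.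
  move=> [b /= bn <-]; rewrite /next_shift /shift_seq mem_cat !inE.
  case: ifPn => bu; first by rewrite eqxx.
  case: ifPn => bv; first by rewrite eqxx orbT.
  by rewrite ifT ?inE ?eqxx ?orbT//; lia.
rewrite /= /shift_seq mem_cat !inE => /orP[/orP[/eqP->|/eqP->]|].
(* Witnesses [0], [v] and [v - 1]; the last one falls in the third branch exactly when
   [n < u + v]. *)
- by exists 0; [rewrite /=; lia|rewrite /next_shift ifT//; lia].
- by exists v; [rewrite /=; lia|rewrite /next_shift ifF ?lexx//; lia].
- case: ifP => // h; rewrite inE => /eqP ->.
  by exists (v - 1); [rewrite /=; lia|rewrite /next_shift ifF ?ifF//; lia].
Qed.

Lemma pythagorean_ratios (R : realType) (n : nat) (x : nat -> R)
    (u p v q : int) :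
  farey_pair (log2_3 R) u p v q -> u < n -> v < n -> n%:Z <= u + v ->
  (forall j, (j < n)%N -> x j < x j.+1) ->
  (x @` `I_n.+1 = pythagorean_scale n)%classic ->
  ([set x j.+1 / x j | j in `I_n] =
   [set` [seq pyth R s.1 s.2 | s <- shift_seq u p v q n]])%classic.
Proof.
move=> fp un vn nuv incx imx.
have [u0 v0 _ _ _] := fp.
have := next_shift_image u p v q n; rewrite u0 un v0 vn nuv.
move=> /(_ isT isT isT)/seteqP[sub1 sub2].
have memP b : 0 <= b < n%:Z ->
    let s := next_shift u p v q n b in
    pyth R s.1 s.2 \in [seq pyth R s.1 s.2 | s <- shift_seq u p v q n].
  move=> bn; apply: (map_f (fun s => pyth R s.1 s.2)).
  by apply: sub1; exists b.
have rat b a j := pythagorean_ratio R n x u p v q b a j fp un vn nuv incx imx.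
apply/seteqP; split=> [_ [j /= jn <-]|y /mapP[s /sub2[b /= bn <-] ->]].
  have : pythagorean_scale n (x j).
    by rewrite -imx; exists j => //=; exact: ltnW.
  move=> /pythagorean_scaleP[b [a [bn xj _]]].
  by rewrite (rat b a j jn bn xj); apply: memP.
(* Every exponent [b] must be realised by a note with a successor: the floor puts [3 ^ b / 2 ^ a] in
   [[1, 2)], strictly below the end point. *)
set a := Num.floor (b%:~R * log2_3 R).
have /andP[a1 a2] := floor_itv (b%:~R * log2_3 R); rewrite -/a intrD in a1 a2.
have l1 : 0 <= lin (log2_3 R) b a < 1 by rewrite /lin; lra.
have : pythagorean_scale n (pyth R b a).
  by apply/pythagorean_scaleP; exists b, a; split=> //; lra.
have : pythagorean_scale n (pyth R 0 (-1)).
  apply/pythagorean_scaleP; exists 0, (-1).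
  by split=> //; [lia|rewrite lin0 rmorphN opprK; lra].
rewrite -imx => -[k /= kn xk] [j /= jn xj].
have {}jn : (j < n)%N.
  rewrite ltn_neqAle -ltnS jn andbT; apply/eqP => ejn.
  have : x j < x k.
    by rewrite xj xk lt_pyth lin0 rmorphN opprK; case/andP: l1.
  rewrite ltNge => /negP; apply.
  have [-> //|kj] : k = j \/ (k < j)%N by lia.
  by apply: ltW; apply: (increasing_lt R x n) => //; rewrite ejn.
by exists j => //; rewrite (rat b a j jn bn xj).
Qed.

(** [step_property] asks for an enumeration to exist. One note in [[1, 2)] for each [b < n],
    together with 2, gives [n + 1] distinct reals to sort. *)
Lemma pythagorean_enum (R : realType) (n : nat) :
  (0 < n)%N -> exists x : nat -> R,
  (forall j, (j < n)%N -> x j < x j.+1) /\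
  (x @` `I_n.+1 = pythagorean_scale n)%classic.
Proof.
move=> n0.
pose f (b : nat) := pyth R b (Num.floor (b%:R * log2_3 R)).
have linf (b : nat) : 0 <= lin (log2_3 R) b (Num.floor (b%:R * log2_3 R)) < 1.
  have := floor_itv (b%:R * log2_3 R); rewrite intrD /lin pmulrn; lra.
pose t := pyth R 0 (-1) :: [seq f b | b <- iota 0 n].
have ft (b : nat) : f b < pyth R 0 (-1).
  by rewrite lt_pyth lin0 rmorphN opprK; case/andP: (linf b).
have ut : uniq t.
  rewrite /= map_inj_uniq ?iota_uniq ?andbT.
    by apply/mapP => -[b _ e]; have := ft b; rewrite -e ltxx.
  by move=> b c /pyth_inj[[]].
have szt : size t = n.+1 by rewrite /= size_map size_iota.
have tE y : y \in t <-> pythagorean_scale n y.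
  rewrite inE; split.
    case/predU1P => [->|/mapP[b]]; last first.
      rewrite mem_iota => bn ->; apply/pythagorean_scaleP.
      exists b, (Num.floor (b%:R * log2_3 R)); split=> //.
      by have /andP[-> /ltW ->] := linf b.
    apply/pythagorean_scaleP; exists 0, (-1).
    by split=> //; rewrite lin0 rmorphN opprK; lra.
  move=> /pythagorean_scaleP[b [a [bn -> /andP[h0 h1]]]].
  (* Height exactly 1 forces [b = 0] by irrationality, which is the end point; otherwise [a] is the
     floor of [b log2 3]. *)
  move: h1; rewrite le_eqVlt => /predU1P[h1|h1].
    have e : lin (log2_3 R) b (a + 1) = 0 by move: h1; rewrite /lin intrD; lra.
    have b0 := log2_3_irrational R _ _ e.
    move: e; rewrite b0 lin0 => /eqP; rewrite oppr_eq0 intr_eq0 addr_eq0.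
    by move=> /eqP ->; rewrite eqxx.
  apply/orP; right; apply/mapP; exists `|b|%N; first by rewrite mem_iota; lia.
  rewrite /f (_ : `|b|%N%:R = b%:~R); last by rewrite pmulrn; congr _%:~R; lia.
  rewrite gez0_abs; last by case/andP: bn.
  by congr pyth; apply/esym/floor_def; move: h0 h1; rewrite /lin intrD; lra.
have [s [srt szs sE]] : exists s : seq R, [/\ sorted <%R s, size s = n.+1 &
    forall y, y \in s <-> pythagorean_scale n y].
  exists (sort <=%R t); rewrite sort_lt_sorted size_sort szt.
  by split=> // y; rewrite mem_sort.
exists (nth 0 s); split=> [j jn|].
  by rewrite (lt_sorted_ltn_nth _ srt) ?inE ?szs // ltnS ltnW.
apply/seteqP; split=> [_ [j /= jn <-]|y /sE /(nthP 0)[j]].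
  by apply/sE/mem_nth; rewrite szs.
by rewrite szs => jn <-; exists j.
Qed.

Lemma step_property_shift_seq (R : realType) (n k : nat) (u p v q : int) :
  farey_pair (log2_3 R) u p v q -> u < n -> v < n -> n%:Z <= u + v ->
  step_property R n k <-> k = size (shift_seq u p v q n).
Proof.
move=> fp un vn nuv.
have [u0 v0 _ _ _] := fp.
have card_ratios :
  ([set` [seq pyth R s.1 s.2 | s <- shift_seq u p v q n]]%classic
   #= `I_(size (shift_seq u p v q n)))%card.
  rewrite -(size_map (fun s => pyth R s.1 s.2)); apply: card_eq_seq.
  rewrite map_inj_uniq; last by move=> [? ?] [? ?] /pyth_inj[/= -> ->].
  (* [u], [- v] and [u - v] are pairwise distinct because [u] and [v] are positive. *)
  by rewrite /shift_seq; case: ifP => _; rewrite /= !inE !xpair_eqE; lia.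
split=> [[x [incx imx card]]|->].
  rewrite (pythagorean_ratios R n x u p v q) // in card.
  by apply/card_eq_II; apply: card_eq_trans card_ratios; rewrite card_eq_sym.
have n0 : (0 < n)%N by lia.
have [x [incx imx]] := pythagorean_enum R n n0.
by exists x; split=> //; rewrite (pythagorean_ratios R n x u p v q).
Qed.

(** * The two-step criterion *)

Theorem theorem1 (R : realType) (n : nat) (hn : (2 <= n)%N) :
  step_property R n 2 <->
  exists q : rat, semiconvergent (log2_3 R) q /\ denq q = n%:Z.
Proof.
have irr := log2_3_irrational R; have c1 := cf_coef_log2_3_1 R.
(* Two steps means that the third shift is absent, that is [u + v <= n]. *)
have two u p v q : farey_pair (log2_3 R) u p v q -> u < n -> v < n ->
    n%:Z <= u + v -> step_property R n 2 <-> n%:Z = u + v.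
  move=> fp un vn nuv.
  apply: (iff_trans (step_property_shift_seq R n 2 u p v q fp un vn nuv)).
  by rewrite /shift_seq; case: ifP => h /=; split => //; lia.
apply: iff_trans (iff_sym (semiconvergent_denqP R _ _ irr)).
split=> [st|[i [k [i0 kK en]]]].
  have [i [k [i0 kK h1 h2 h3]]] := semiconvergent_den_cover R _ n irr c1 hn.
  have [u [p [v [q [fp uv]]]]] := semiconvergent_farey_pair R _ i k irr i0 kK.
  exists i, (k + 1); split=> //; first lia.
  have -> : n%:Z = u + v by apply/(two u p v q) => //; lia.
  by lia.
(* Rewriting [n] as [u + v] with [u], [v] positive also yields the bounds [u, v < n]. *)
have [|i' [k' [i'0 kK' e]]] := semiconvergent_den_gt1 R _ i k irr c1 i0 kK.
  by rewrite -en.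
have [u [p [v [q [fp uv]]]]] := semiconvergent_farey_pair R _ i' k' irr i'0 kK'.
have [u0 v0 _ _ _] := fp.
by apply/(two u p v q) => //; lia.
Qed.
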